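(* Let $A\in\mathbb{R}^{m\times n}$, $b\in\mathbb{R}^m$ with the linear system $Ax=b$ consistent, let $r=\operatorname{rank}(A)$ and $1\le s\le r$. Let $x^0\in\mathbb{R}^n$ be arbitrary and let $\{x^k\}_{k\ge0}$ be generated by $$x^{k+1}=x^k-A_{\mathcal{S}_k}^\dagger(A_{\mathcal{S}_k}x^k-b_{\mathcal{S}_k}),$$ where at each iteration $\mathcal{S}_k\sim\operatorname{Vol}_s(AA^\top)$ is drawn independently of the past. Let $x^0_*:=A^\dagger b+(I-A^\dagger A)x^0$. Then for all $k\ge 0$, $$\big\|\mathbb{E}[x^k-x^0_*]\big\|_2^2\le(1-\rho_{A,s})^{2k}\|x^0-x^0_*\|_2^2,\qquad \rho_{A,s}:=\frac{\sigma_{\min}^2(A)}{\sigma_s^2(A)+\cdots+\sigma_{\min}^2(A)}.$$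
   Context: $\sigma_1(A)\ge\cdots\ge\sigma_r(A)=:\sigma_{\min}(A)>0$ are the nonzero singular values of $A$. For $\mathcal{S}\subseteq[m]$, $A_{\mathcal{S}}$ and $b_{\mathcal{S}}$ are the row submatrix of $A$ and subvector of $b$ indexed by $\mathcal{S}$, and $\dagger$ denotes the Moore–Penrose pseudoinverse. Volume sampling: $\mathcal{S}\sim\operatorname{Vol}_s(AA^\top)$ means $\mathcal{S}$ takes values in the $s$-element subsets of $[m]$ with $\mathbb{P}(\mathcal{S}=\mathcal{T})=\det(A_{\mathcal{T}}A_{\mathcal{T}}^\top)/\sum_{|\mathcal{J}|=s}\det(A_{\mathcal{J}}A_{\mathcal{J}}^\top)$. *)

(* Defs.v *)
From Stdlib Require Import ClassicalEpsilon.
From mathcomp Require Import all_boot all_order all_algebra reals.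
Set Implicit Arguments. Unset Strict Implicit. Unset Printing Implicit Defensive.
Import Order.TTheory GRing.Theory Num.Theory.
Local Open Scope ring_scope.

Section Defs.
Variable R : realType.

(* Moore--Penrose pseudoinverse: the (unique) X satisfying the four Penrose
   equations, chosen by classical choice. *)
Definition penrose (m n : nat) (A : 'M[R]_(m, n)) (X : 'M[R]_(n, m)) : Prop :=
  [/\ A *m X *m A = A, X *m A *m X = X,
      (A *m X)^T = A *m X & (X *m A)^T = X *m A].

Definition pinv (m n : nat) (A : 'M[R]_(m, n)) : 'M[R]_(n, m) :=
  epsilon (inhabits 0) (penrose A).

Definition subrows (m n : nat) (S : {set 'I_m}) (A : 'M[R]_(m, n))
  : 'M[R]_(#|S|, n) := rowsub (fun i : 'I_#|S| => enum_val i) A.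

(* Eigenvalues of a square matrix (with multiplicity) as a nonincreasing list,
   when its characteristic polynomial splits over R (chosen by choice). *)
Definition eigs (n : nat) (M : 'M[R]_n) : seq R :=
  epsilon (inhabits [::])
    (fun l => sorted >=%R l /\ char_poly M = \prod_(x <- l) ('X - x%:P)).

(* Singular values sigma_1 >= sigma_2 >= ... (1-indexed): square roots of the
   eigenvalues of A^T A. The nonzero ones are sigma_1, ..., sigma_(rank A). *)
Definition sigma (m n : nat) (A : 'M[R]_(m, n)) (i : nat) : R :=
  Num.sqrt (nth 0 (eigs (A^T *m A)) i.-1).

(* rho_{A,s} = sigma_min^2 / (sigma_s^2 + ... + sigma_min^2), sigma_min = sigma_r *)
Definition rho (m n : nat) (A : 'M[R]_(m, n)) (s : nat) : R :=
  sigma A (\rank A) ^+ 2 / \sum_(s <= i < (\rank A).+1) sigma A i ^+ 2.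

Definition vol_weight (m n : nat) (A : 'M[R]_(m, n)) (T : {set 'I_m}) : R :=
  \det (subrows T A *m (subrows T A)^T).

Definition vol_prob (m n : nat) (A : 'M[R]_(m, n)) (s : nat) (T : {set 'I_m}) : R :=
  if #|T| == s then
    vol_weight A T / \sum_(J : {set 'I_m} | #|J| == s) vol_weight A J
  else 0.

Definition step (m n : nat) (A : 'M[R]_(m, n)) (b : 'cV[R]_m)
  (S : {set 'I_m}) (x : 'cV[R]_n) : 'cV[R]_n :=
  x - pinv (subrows S A) *m (subrows S A *m x - subrows S b).

Fixpoint iterate (m n : nat) (A : 'M[R]_(m, n)) (b : 'cV[R]_m)
  (x0 : 'cV[R]_n) (Ss : nat -> {set 'I_m}) (k : nat) : 'cV[R]_n :=
  match k with
  | 0 => x0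
  | k'.+1 => step A b (Ss k') (iterate A b x0 Ss k')
  end.

(* E[x^k - x_*] with S_0, ..., S_{k-1} i.i.d. ~ Vol_s(A A^T): expectation
   under the product distribution on k-tuples of index sets. *)
Definition expect_diff (m n : nat) (A : 'M[R]_(m, n)) (b : 'cV[R]_m)
  (s : nat) (x0 xs : 'cV[R]_n) (k : nat) : 'cV[R]_n :=
  \sum_(f : {ffun 'I_k -> {set 'I_m}})
     (\prod_(i < k) vol_prob A s (f i)) *:
       (iterate A b x0 (fun j => if insub j is Some i then f i else set0) k - xs).

Definition sqnorm (n : nat) (v : 'cV[R]_n) : R := \sum_(i < n) v i 0 ^+ 2.

End Defs.

(* Main.v *)
(** Let G = A^T A have orthonormal eigenvectors u_i and eigenvalues lam_i, and let
    P_S = pinv(A_S) A_S and w_S = det(A_S A_S^T).  By Sylvester's determinant identity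
      w_S (1 + v P_S u^T) = det(A_S (1 + u^T v) A_S^T)    (u, v row vectors),
    and summing principal minors of A (1 + u^T v) A^T turns this into
      sum_S X^|S| w_S (1 + v P_S u^T) = det(1 + X G (1 + u^T v)).
    Taking u and v among the u_i shows that E[P_S] is diagonal in the eigenbasis of G, with
    entries lam_i e_{s-1}(lam without lam_i) / e_s(lam), the e_s being the elementary symmetric
    polynomials, read off as coefficients of prod_i (1 + lam_i X).  For lam_i > 0 this entry is
    at least its value at the smallest positive eigenvalue lam_r, and
      e_s(lam) <= e_{s-1}(lam_1, ..., lam_{r-1}) (lam_s + ... + lam_r)
    bounds it below by rho.  Finally E[x^k - xs] = (1 - E[P_S])^k (x^0 - xs) by independence,
    and x^0 - xs is orthogonal to the kernel of A. *)

From Stdlib Require Import ClassicalEpsilon.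
Require Import Defs.
From mathcomp Require Import all_boot all_order all_algebra fingroup perm complex reals.
Import Order.TTheory GRing.Theory Num.Theory.
Local Open Scope ring_scope.
Set Implicit Arguments. Unset Strict Implicit. Unset Printing Implicit Defensive.

(** * Determinant identities *)

(** Both sides come from block triangular factorizations of one matrix. No inverse is taken, so the
    identity also serves over [{poly R}]. *)
Lemma det_1addM_comm (R : comNzRingType) m n (B : 'M[R]_(m, n)) (C : 'M[R]_(n, m)) :
  \det (1%:M + B *m C) = \det (1%:M + C *m B).
Proof.
have E1 : block_mx 1%:M (- B) C 1%:M
        = block_mx 1%:M 0 C 1%:M *m block_mx 1%:M (- B) 0 (1%:M + C *m B).
  rewrite mulmx_block ?mulmx1 ?mul1mx ?mul0mx ?mulmx0 ?addr0 mulmxN.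
  by rewrite addrCA addNr addr0.
have E2 : block_mx 1%:M (- B) C 1%:M
        = block_mx (1%:M + B *m C) (- B) 0 1%:M *m block_mx 1%:M 0 C 1%:M.
  by rewrite mulmx_block ?mulmx1 ?mul1mx ?mulmx0 ?mul0mx ?add0r mulNmx addrK.
have := congr1 determinant E2; rewrite E1 !det_mulmx !det_ublock !det_lblock !det1.
by rewrite !mul1r !mulr1.
Qed.

Lemma mxsub_rowsub1 (R : nzRingType) m p (f : 'I_p -> 'I_m) (M : 'M[R]_m) :
  mxsub f f M = rowsub f 1%:M *m M *m (rowsub f 1%:M)^T.
Proof.
by rewrite -rowsubE trmx_mxsub trmx1 -mxsub_mul mulmx1.
Qed.

Definition set_elt m (S : {set 'I_m}) (i : 'I_#|S|) : 'I_m := enum_val i.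

Lemma set_elt_inj m (S : {set 'I_m}) : injective (@set_elt m S).
Proof. exact: enum_val_inj. Qed.

Lemma set_eltP m (S : {set 'I_m}) i : i \in S -> exists k, i = @set_elt m S k.
Proof. by move=> iS; exists (enum_rank_in iS i); rewrite /set_elt enum_rankK_in. Qed.

(** In the Leibniz formula each product of entries of [1 + x M] expands over the set [S] of rows
    that contribute [M]. The other rows are those of the identity, which leaves a principal
    minor. *)
Lemma det_1addZ_principal_minors (R : comNzRingType) m (x : R) (M : 'M[R]_m) :
  \det (1%:M + x *: M) =
  \sum_(S : {set 'I_m}) x ^+ #|S| * \det (mxsub (@set_elt m S) (@set_elt m S) M).
Proof.
have E (S : {set 'I_m}) :
    \det (mxsub (@set_elt m S) (@set_elt m S) M)
    = \det (\matrix_(i, j) if i \in S then M i j else (i == j)%:R).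
  rewrite mxsub_rowsub1; set E := rowsub _ _.
  have EE : E *m E^T = 1%:M.
    apply/matrixP=> i j; rewrite -rowsubE !mxE.
    by rewrite eq_sym (inj_eq (@set_elt_inj _ _)).
  (* Sylvester's identity moves this to size [m], where [E^T *m E] is the diagonal
     0/1 matrix of [S]. *)
  have -> : E *m M *m E^T = 1%:M + (E *m M - E) *m E^T.
    by rewrite mulmxBl EE addrC subrK.
  rewrite -det_1addM_comm; congr (\det _); apply/matrixP=> i j.
  have EtE (B : 'M[R]_m) : (E^T *m (E *m B)) i j = if i \in S then B i j else 0.
    rewrite mxE; under eq_bigr do rewrite -rowsubE !mxE.
    case: ifPn => iS.
      have [k ->] := set_eltP iS.
      rewrite (bigD1 k) //= eqxx mul1r big1 ?addr0 // => l lk.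
      by rewrite (inj_eq (@set_elt_inj _ _)) (negPf lk) mul0r.
    rewrite big1 // => k _; rewrite [_ == _](_ : _ = false) ?mul0r //.
    by apply: contraNF iS => /eqP <-; apply: enum_valP.
  have EtE1 : (E^T *m E) i j = if i \in S then (i == j)%:R else 0.
    by rewrite -[E in _ *m E]mulmx1 EtE mxE.
  rewrite mulmxBr [RHS]mxE.
  transitivity ((i == j)%:R + ((E^T *m (E *m M)) i j - (E^T *m E) i j)).
    by rewrite !mxE.
  rewrite EtE EtE1.
  by case: ifP => _; rewrite ?subrr ?addr0 // addrC subrK.
rewrite [LHS]/determinant.
under eq_bigr => s _ do under eq_bigr => i _ do rewrite !mxE.
under eq_bigr => s _ do
  (under eq_bigr => i _ do rewrite addrC; rewrite bigA_distr mulr_sumr).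
rewrite exchange_big /=; apply: eq_bigr => S _.
rewrite E /determinant mulr_sumr; apply: eq_bigr => s _.
rewrite mulrCA; congr (_ * _).
rewrite -prodr_const.
rewrite [X in X * _]big_mkcond -big_split /=; apply: eq_bigr => i _.
by rewrite mxE; case: ifP; rewrite ?mul1r.
Qed.

Lemma det_diagD_delta (R : comNzRingType) n (D : 'rV[R]_n) (c : R) i j :
  \det (diag_mx D + c *: delta_mx i j)
  = \prod_k D 0 k + c *+ (i == j) * \prod_(k | k != i) D 0 k.
Proof.
(* Entry [i] becomes 1 since [D 0 i] need not be invertible; a rank-one update of row [i] restores
   it. *)
pose D' : 'rV[R]_n := \row_k if k == i then 1 else D 0 k.
have -> : diag_mx D + c *: delta_mx i j = diag_mx D' *m
   (1%:M + delta_mx i 0 *m ((D 0 i - 1) *: delta_mx 0 i + c *: delta_mx 0 j : 'rV_n)).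
  apply/matrixP=> k l; rewrite mul_diag_mx !mxE big_ord1 !mxE !eqxx ?andbT /=.
  case: (eqVneq k i) => [->|ki] /=; last by rewrite mulr0 mul0r !addr0 mulr_natr.
  rewrite !mul1r -[D 0 i *+ _]mulr_natr (eq_sym l i) mulrBl mul1r addrA.
  by rewrite (addrC (i == l)%:R) subrK.
rewrite det_mulmx det_diag det_1addM_comm (bigD1 i) //= mxE eqxx mul1r.
rewrite mulmxDl -!scalemxAl !mul_delta_mx_cond det_mx11 !mxE !eqxx mulr1n.
have delta00 (t : bool) : (delta_mx 0 0 *+ t : 'M[R]_1) 0 0 = t%:R.
  by rewrite mulmxnE mxE.
rewrite !delta00 mulr1 addrA [1 + _]addrC subrK mulrDr.
have -> : \prod_(k | k != i) D' 0 k = \prod_(k | k != i) D 0 k.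
  by apply: eq_bigr => k /negPf ki; rewrite mxE ki.
rewrite [in RHS](bigD1 i) //= mulr_natr eq_sym.
by congr (_ + _); rewrite mulrC.
Qed.

(** * Spectral theorem for real symmetric matrices *)

Lemma sqr_row_ge0 (R : realDomainType) n (v : 'rV[R]_n) : 0 <= (v *m v^T) 0 0.
Proof. by rewrite mxE sumr_ge0 // => i _; rewrite mxE -expr2 sqr_ge0. Qed.

Lemma sqr_row_eq0 (R : realDomainType) n (v : 'rV[R]_n) :
  ((v *m v^T) 0 0 == 0) = (v == 0).
Proof.
apply/eqP/eqP => [|->]; last by rewrite mul0mx mxE.
rewrite mxE => /eqP; rewrite psumr_eq0 => [/allP v0|i _]; last first.
  by rewrite mxE -expr2 sqr_ge0.
apply/rowP => i; have := v0 i (mem_index_enum i).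
by rewrite !mxE mulf_eq0 orbb => /eqP.
Qed.

(** An eigenvector [v] exists over the complex numbers. Computing [v G v^*] in two ways shows that
    its eigenvalue is real, and a real eigenvalue descends to [R]. *)
Lemma symmetric_eigenvalue (R : rcfType) n (G : 'M[R]_n.+1) :
  G^T = G -> exists a, eigenvalue G a.
Proof.
move=> Gsym; pose toC := real_complex R; pose GC := map_mx toC G.
have [a /eigenvalueP[v vG v0]] := @eigenvalue_closed _ _ GC isT.
pose vs := map_mx Num.conj v^T.
have GCs : map_mx Num.conj GC^T = GC.
  apply/matrixP => i j; rewrite !mxE -[G in LHS]Gsym mxE.
  by apply/CrealP; rewrite complex_real.
have aR : a^* = a.
  have E1 : v *m GC *m vs = a *: (v *m vs) by rewrite vG scalemxAl.
  have E2 : v *m GC *m vs = a^* *: (v *m vs).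
    rewrite -mulmxA; have -> : GC *m vs = a^* *: vs.
      rewrite -{1}GCs /vs -map_mxM -trmx_mul vG.
      by apply/matrixP => i j; rewrite !mxE rmorphM.
    by rewrite scalemxAr.
  move: E2; rewrite E1 => /matrixP/(_ 0 0); rewrite !mxE => /mulIf H; apply/esym/H.
  have vge0 i : 0 <= v 0 i * vs i 0 by rewrite !mxE mul_conjC_ge0.
  rewrite psumr_eq0 //; apply: contraNN v0 => /allP v0.
  apply/eqP/rowP => i; have := v0 i (mem_index_enum i).
  by rewrite !mxE mul_conjC_eq0 => /eqP.
have [r ar] : exists r, a = toC r.
  have : a \is Num.real by apply/CrealP.
  by move=> /complex_realP [r ->]; exists r.
exists r; rewrite -(eigenvalue_map (real_complex R)); apply/eigenvalueP.
by exists v; rewrite // -/toC -/GC vG ar.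
Qed.

Lemma unit_row_orthogonal_completion (R : rcfType) n (v : 'rV[R]_n.+1) :
  v *m v^T = 1%:M ->
  exists2 Q : 'M[R]_n.+1, Q *m Q^T = 1%:M & delta_mx 0 0 *m Q = v.
Proof.
move=> v1; pose e : 'rV[R]_n.+1 := delta_mx 0 0; pose w := v - e.
have [w0|w0] := eqVneq w 0.
  by exists 1%:M; rewrite ?trmx1 mulmx1 //; move/subr0_eq: w0 => ->.
pose c := (w *m w^T) 0 0.
have c0 : c != 0 by rewrite sqr_row_eq0.
have wwT : w *m w^T = c%:M by rewrite [LHS]mx11_scalar.
(* Householder reflection exchanging [e] and [v] *)
pose Q : 'M[R]_n.+1 := 1%:M - (2 / c) *: (w^T *m w).
have QT : Q^T = Q by rewrite /Q linearB linearZ /= trmx1 trmx_mul trmxK.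
exists Q.
  pose P := w^T *m w.
  have PP : P *m P = c *: P.
    by rewrite /P mulmxA -[w^T *m w *m w^T]mulmxA wwT mul_mx_scalar -scalemxAl.
  rewrite QT /Q -/P mulmxBr mulmx1 -scalemxAr mulmxBl mul1mx -scalemxAl PP.
  rewrite scalerA divfK // scalerBr scalerA -mulrA.
  have -> : 2 * (c^-1 * 2) = 2 / c + 2 / c by rewrite mulrA mulr_natr mulr2n.
  by rewrite scalerDl opprB addrK subrK.
have eT (x : 'rV[R]_n.+1) : e *m x^T = (x 0 0)%:M :> 'M_1.
  by rewrite /e -rowE [LHS]mx11_scalar !mxE.
have xeT (x : 'rV[R]_n.+1) : x *m e^T = (x 0 0)%:M :> 'M_1.
  by rewrite -[LHS]trmxK trmx_mul trmxK eT tr_scalar_mx.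
have ewT : e *m w^T = (v 0 0 - 1)%:M by rewrite eT !mxE.
(* As [e] and [v] are unit rows, the reflection adds exactly [w] to [e]. *)
have cE : c = 2 * (1 - v 0 0).
  rewrite /c /w linearB /= mulmxBl !mulmxBr v1 eT !xeT !mxE /=.
  by rewrite mulr2n mulrDl mul1r opprB addrA.
rewrite -/e /Q mulmxBr mulmx1 -scalemxAr mulmxA ewT mul_scalar_mx scalerA.
have -> : 2 / c * (v 0 0 - 1) = - 1.
  by rewrite -[v 0 0 - 1]opprB mulrN mulrAC -cE mulfV.
by rewrite scaleN1r opprK /w addrC subrK.
Qed.

(** Deflation: in an orthonormal basis starting with an eigenvector, the first row of [G], and by
    symmetry its first column, vanish off the diagonal. Induction handles the remaining block. *)
Lemma symmetric_orthogonal_diag (R : rcfType) n (G : 'M[R]_n) : G^T = G ->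
  exists U : 'M[R]_n, exists2 d : 'rV[R]_n,
    U *m U^T = 1%:M & U *m G = diag_mx d *m U.
Proof.
elim: n G => [|n IHn] G Gsym; first by exists 0, 0; apply/matrixP => -[].
have [a /eigenvalueP[v0 v0G v0n0]] := symmetric_eigenvalue Gsym.
pose c := Num.sqrt ((v0 *m v0^T) 0 0); pose v := c^-1 *: v0.
have c2 : (v0 *m v0^T) 0 0 = c ^+ 2 by rewrite sqr_sqrtr // sqr_row_ge0.
have c0 : c != 0.
  by apply: contraNneq v0n0 => c0; rewrite -sqr_row_eq0 c2 c0 expr0n.
have v1 : v *m v^T = 1%:M.
  rewrite linearZ /= -scalemxAl -scalemxAr scalerA [v0 *m _]mx11_scalar c2.
  by rewrite scale_scalar_mx -expr2 exprVn mulVf ?expf_neq0.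
have vG : v *m G = a *: v by rewrite -scalemxAl v0G !scalerA mulrC.
have [Q QQ eQ] := unit_row_orthogonal_completion v1.
pose H : 'M[R]_(1 + n) := Q *m G *m Q^T.
have QQ' : Q^T *m Q = 1%:M by apply: mulmx1C.
have HT : H^T = H by rewrite /H !trmx_mul trmxK Gsym mulmxA.
have eH : delta_mx 0 0 *m H = a *: (delta_mx 0 0 : 'rV_(1 + n)).
  by rewrite /H !mulmxA eQ vG -eQ -!scalemxAl -mulmxA QQ mulmx1.
have H0 j : H 0 j = a * (j == 0)%:R.
  by move/rowP/(_ j): eH; rewrite -rowE !mxE /=.
have Hul : ulsubmx H = a%:M.
  apply/matrixP => i j; rewrite !ord1 ulsubmxEsub mxE.
  have -> : lshift n 0 = 0 :> 'I_(1 + n) by apply/val_inj.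
  by rewrite H0 !mxE mulr_natr.
have Hur : ursubmx H = 0.
  apply/matrixP => i j; rewrite !ord1 ursubmxEsub mxE.
  have -> : lshift n 0 = 0 :> 'I_(1 + n) by apply/val_inj.
  by rewrite H0 !mxE mulr0.
have Hdl : dlsubmx H = 0 by rewrite -[H]HT -trmx_ursub Hur trmx0.
have [|U [d UU Ud]] := IHn (drsubmx H).
  by rewrite trmx_drsub HT.
pose W : 'M[R]_(1 + n) := block_mx 1%:M 0 0 U.
have WW : W *m W^T = 1%:M.
  rewrite /W tr_block_mx !trmx0 trmx1 mulmx_block !mul0mx !mulmx0 mulmx1 UU.
  by rewrite !addr0 !add0r -scalar_mx_block.
have WH : W *m H = diag_mx (row_mx a%:M d) *m W.
  rewrite -[H]submxK Hul Hur Hdl diag_mx_row !mulmx_block.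
  rewrite !mul0mx !mulmx0 !mulmx1 !mul1mx Ud !addr0 !add0r.
  by congr (block_mx _ _ _ _); apply/matrixP => i j; rewrite !ord1 !mxE.
exists (W *m Q), (row_mx a%:M d).
  by rewrite trmx_mul mulmxA -[W *m Q *m _]mulmxA QQ mulmx1.
rewrite mulmxA -WH /H !mulmxA.
by rewrite -[in RHS](mulmxA _ Q^T) QQ' mulmx1.
Qed.

(** * Pseudoinverse and Gram spectrum *)

Section Gram.
Variables (R : realType) (m n : nat) (A : 'M[R]_(m, n)).
Variables (U : 'M[R]_n) (d : 'rV[R]_n).
Hypotheses (UU : U *m U^T = 1%:M) (UG : U *m (A^T *m A) = diag_mx d *m U).

Lemma gram_diag : A^T *m A = U^T *m diag_mx d *m U.
Proof. by rewrite -mulmxA -UG mulmxA (mulmx1C UU) mul1mx. Qed.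

(** The quadratic form of [A^T *m A] at a unit eigenvector. It yields the sign of [d] and shows that
    [A] kills the eigenvectors of eigenvalue 0. *)
Lemma gram_eigenvalue_sqr i : d 0 i = (row i U *m A^T *m (row i U *m A^T)^T) 0 0.
Proof.
rewrite trmx_mul trmxK mulmxA -[_ *m A^T *m A]mulmxA -row_mul UG.
rewrite row_mul row_diag_mx -mulmxA -scalemxAl -rowE tr_row.
by rewrite mulmx_colsub UU !mxE eqxx mulr1.
Qed.

Lemma gram_eigenvalue_ge0 i : 0 <= d 0 i.
Proof. by rewrite gram_eigenvalue_sqr sqr_row_ge0. Qed.

Lemma gram_eigenvalue0 i : d 0 i = 0 -> row i U *m A^T = 0.
Proof. by rewrite gram_eigenvalue_sqr => /eqP; rewrite sqr_row_eq0 => /eqP. Qed.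

Lemma gram_support (f : 'rV[R]_n) : (forall i, d 0 i != 0 -> f 0 i = 1) ->
  diag_mx f *m U *m A^T = U *m A^T.
Proof.
move=> f1; rewrite -mulmxA; apply/row_matrixP => i.
rewrite row_mul row_diag_mx -scalemxAl -rowE row_mul.
have [/gram_eigenvalue0 ->|/f1 ->] := eqVneq (d 0 i) 0; last by rewrite scale1r.
by rewrite scaler0.
Qed.

Lemma mxrank_gram_diag q : (q <= n)%N -> (forall i, (d 0 i != 0) = (i < q)%N) ->
  \rank A = q.
Proof.
move=> qn dq; have rA : \rank A = \rank (U *m A^T).
  rewrite -mxrank_tr -[RHS]mxrank_tr trmx_mul trmxK mxrank_tr mxrankMfree //.
  by rewrite row_free_unit; case: (mulmx1_unit UU).
have fE : diag_mx (\row_i (i < q)%:R) = pid_mx q :> 'M[R]_n.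
  apply/matrixP => i j; rewrite !mxE; case: (eqVneq i j) => [->|ij].
    by rewrite eqxx mulr1n.
  by rewrite mulr0n; move: ij; rewrite -val_eqE /= => /negPf ->.
apply/eqP; rewrite rA eqn_leq; apply/andP; split.
  rewrite -[U *m A^T](@gram_support (\row_i (i < q)%:R)); last first.
    by move=> i; rewrite dq mxE => ->.
  by rewrite fE -mulmxA (leq_trans (mxrankM_maxl _ _)) // rank_pid_mx.
(* Lower bound on the rank: as [0^-1 = 0], an eigenvalue times its inverse is the indicator of
   [i < q]. *)
have E : U *m A^T *m (A *m U^T *m diag_mx (\row_i (d 0 i)^-1)) = pid_mx q.
  rewrite !mulmxA -[U *m A^T *m A]mulmxA UG -[_ *m U *m U^T]mulmxA UU mulmx1.
  rewrite mulmx_diag -fE; congr diag_mx; apply/rowP => i; rewrite !mxE -dq.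
  by have [->|d0] := eqVneq (d 0 i) 0; rewrite ?mul0r // divff.
by rewrite -(rank_pid_mx R qn qn) -E mxrankM_maxl.
Qed.

End Gram.

Lemma pinvP (R : realType) m n (A : 'M[R]_(m, n)) : penrose A (pinv A).
Proof.
apply: epsilon_spec.
have [|U [d UU UG]] := @symmetric_orthogonal_diag R n (A^T *m A).
  by rewrite trmx_mul trmxK.
(* As [0^-1 = 0], [e] inverts the nonzero eigenvalues only and [f] is their indicator. The witness
   [X] below is the pseudoinverse of [A^T *m A] times [A^T]. *)
pose e : 'rV[R]_n := \row_i (d 0 i)^-1; pose f : 'rV[R]_n := \row_i (d 0 i / d 0 i).
have ef : diag_mx e *m diag_mx d = diag_mx f.
  by rewrite mulmx_diag; congr diag_mx; apply/rowP => i; rewrite !mxE mulrC.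
have fe : diag_mx f *m diag_mx e = diag_mx e.
  rewrite mulmx_diag; congr diag_mx; apply/rowP => i; rewrite !mxE.
  have [->|d0] := eqVneq (d 0 i) 0; first by rewrite invr0 mulr0.
  by rewrite divff // mul1r.
have fA : diag_mx f *m U *m A^T = U *m A^T.
  by apply: gram_support UU UG _ _ => i d0; rewrite mxE divff.
have Af : A *m U^T *m diag_mx f = A *m U^T.
  by move/(congr1 trmx): fA; rewrite !trmx_mul !trmxK tr_diag_mx mulmxA.
pose X := U^T *m diag_mx e *m U *m A^T.
have XA : X *m A = U^T *m diag_mx f *m U.
  by rewrite /X -mulmxA -[_ *m U *m _]mulmxA UG mulmxA -ef !mulmxA.
exists X; split.
- by rewrite -mulmxA XA !mulmxA Af -mulmxA (mulmx1C UU) mulmx1.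
- rewrite XA /X -!mulmxA (mulmxA U) UU mul1mx [diag_mx f *m _]mulmxA fe //.
- by rewrite /X !trmx_mul !trmxK tr_diag_mx !mulmxA.
by rewrite XA !trmx_mul !trmxK tr_diag_mx !mulmxA.
Qed.

Lemma pinv_proj_tr (R : realType) m n (A : 'M[R]_(m, n)) :
  (pinv A *m A)^T = pinv A *m A.
Proof. by case: (pinvP A). Qed.

(* If [B *m B^T] is singular both sides vanish, so that index sets of weight zero
   need no separate treatment. *)
Lemma det_gram_update (R : realType) p n (B : 'M[R]_(p, n)) (u v : 'rV[R]_n) :
  \det (B *m (1%:M + u^T *m v) *m B^T)
  = \det (B *m B^T) * (1 + (v *m (pinv B *m B) *m u^T) 0 0).
Proof.
have [uB|nuB] := boolP (B *m B^T \in unitmx); last first.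
  have d0 : \det (B *m B^T) = 0.
    by apply/eqP; move: nuB; rewrite unitmxE unitfE negbK.
  rewrite d0 mul0r; apply/eqP/det0P.
  (* A left kernel vector [y] of [B *m B^T] has [y *m B] of norm 0, so it also kills the updated
     matrix. *)
  have /eqP/det0P [y y0 yB] := d0; exists y => //.
  have : (y *m B) *m (y *m B)^T = 0 by rewrite trmx_mul !mulmxA -[y *m B *m _]mulmxA yB mul0mx.
  move=> yBB; have := sqr_row_eq0 (y *m B).
  rewrite yBB mxE eqxx => /esym/eqP yB0.
  by rewrite !mulmxA yB0 !mul0mx.
have [BXB _ _ XBT] := pinvP B; set X := pinv B in BXB XBT *.
have BX : B *m X = 1%:M.
  by rewrite -[LHS](mulmxK uB) mulmxA BXB mulmxV.
(* The symmetry of [X *m B] turns [B X B = B] into [B B^T X^T = B]. *)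
have XT : X^T = invmx (B *m B^T) *m B.
  apply: (can_inj (mulKmx uB)).
  by rewrite mulKVmx // -mulmxA -trmx_mul XBT mulmxA BXB.
have -> : X *m B = B^T *m invmx (B *m B^T) *m B.
  by rewrite -XBT trmx_mul XT mulmxA.
set K := B *m B^T in uB *.
have -> : B *m (1%:M + u^T *m v) *m B^T
        = K *m (1%:M + (invmx K *m (B *m u^T)) *m (v *m B^T)).
  by rewrite !mulmxDr !mulmx1 mulmxDl [K *m (_ *m _)]mulmxA mulKVmx // !mulmxA.
by rewrite det_mulmx det_1addM_comm det_mx11 mxE [1%:M 0 0]mxE eqxx !mulmxA.
Qed.

Lemma char_poly_orthogonal_diag (R : comNzRingType) n (G U : 'M[R]_n) (d : 'rV[R]_n) :
  U *m U^T = 1%:M -> U *m G = diag_mx d *m U ->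
  char_poly G = \prod_(x <- codom (d 0)) ('X - x%:P).
Proof.
move=> UU UG; pose V := map_mx polyC U.
have VV : V^T *m V = 1%:M.
  by rewrite map_trmx -map_mxM (mulmx1C UU) map_scalar_mx.
have cE : V^T *m char_poly_mx (diag_mx d) *m V = char_poly_mx G.
  rewrite /char_poly_mx mulmxBr mulmxBl mul_mx_scalar -scalemxAl VV scalemx1.
  by rewrite -mulmxA -map_mxM -UG map_mxM mulmxA VV mul1mx.
rewrite big_image /= [LHS]/char_poly -cE !det_mulmx mulrAC -det_mulmx VV det1 mul1r.
rewrite -/(char_poly _) char_poly_trig ?diag_mx_is_trig //.
by apply: eq_bigr => i _; rewrite mxE eqxx mulr1n.
Qed.

(** The chosen list and the diagonal from the spectral theorem split the same characteristic
    polynomial, so they agree up to a permutation, which is then applied to the rows of [U]. *)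
Lemma eigs_gram (R : realType) m n (A : 'M[R]_(m, n)) (l := eigs (A^T *m A)) :
  [/\ size l = n, sorted >=%R l &
   exists2 U : 'M[R]_n, U *m U^T = 1%:M
     & U *m (A^T *m A) = diag_mx (\row_i l`_i) *m U].
Proof.
have [|U [d UU UG]] := @symmetric_orthogonal_diag R n (A^T *m A).
  by rewrite trmx_mul trmxK.
have cG := char_poly_orthogonal_diag UU UG.
have [ls lE] : sorted >=%R l /\ char_poly (A^T *m A) = \prod_(x <- l) ('X - x%:P).
  apply: (epsilon_spec (inhabits [::])
    (fun l => sorted >=%R l /\ char_poly _ = \prod_(x <- l) ('X - x%:P))).
  exists (sort >=%R (codom (d 0))); split.
    by apply: sort_sorted => x y; apply: le_total.
  by rewrite cG; apply: perm_big; rewrite perm_sym perm_sort.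
have lsz : size l = n.
  by have := size_char_poly (A^T *m A); rewrite lE size_prod_XsubC => -[].
split=> //; have /prod_XsubC_eq ld := etrans (esym lE) cG.
have /eqP lsz' := lsz.
have /tuple_permP[p pE] : perm_eq (Tuple lsz') [tuple d 0 i | i < n].
  by rewrite /= (perm_trans ld).
have lp (i : 'I_n) : l`_i = d 0 (p i).
  have /(congr1 (fun s : seq R => s`_i)) := pE; rewrite /= => ->.
  by rewrite (nth_map i) ?size_enum_ord // nth_ord_enum tnth_mktuple.
exists (perm_mx p *m U).
  rewrite trmx_mul tr_perm_mx mulmxA -[_ *m U *m _]mulmxA UU mulmx1.
  by rewrite -perm_mxM mulgV perm_mx1.
rewrite -mulmxA UG -!row_permE; apply/matrixP => i j.
by rewrite mxE !mul_diag_mx !mxE lp.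
Qed.

Lemma eigs_gram_ge0 (R : realType) m n (A : 'M[R]_(m, n)) i :
  0 <= (eigs (A^T *m A))`_i.
Proof.
have [lsz _ [U UU UG]] := eigs_gram A.
have [lt_in|le_ni] := ltnP i n; last by rewrite nth_default ?lsz.
by have := gram_eigenvalue_ge0 UU UG (Ordinal lt_in); rewrite mxE.
Qed.

Lemma eigs_gram_antitone (R : realType) m n (A : 'M[R]_(m, n)) i j :
  (i <= j)%N -> (eigs (A^T *m A))`_j <= (eigs (A^T *m A))`_i.
Proof.
have [lsz ls _] := eigs_gram A; set l := eigs _ in lsz ls * => le_ij.
(* Past the end of the list, the default 0 lies below every eigenvalue. *)
have [le_lj|lt_jl] := leqP (size l) j.
  by rewrite nth_default // eigs_gram_ge0.
have ge_tr : transitive (>=%R : rel R) by move=> x y z xy yz; apply: le_trans yz xy.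
have := sorted_leq_nth ge_tr (@lexx _ R) 0 ls i j; rewrite !inE; apply=> //.
exact: leq_ltn_trans lt_jl.
Qed.

Lemma eigs_gram_neq0 (R : realType) m n (A : 'M[R]_(m, n)) i :
  ((eigs (A^T *m A))`_i != 0) = (i < \rank A)%N.
Proof.
have [lsz ls [U UU UG]] := eigs_gram A; set l := eigs _ in lsz ls UG *.
(* From the first zero on, monotonicity and nonnegativity allow only zeros, so [q] counts the
   nonzero eigenvalues. *)
pose q := find (pred1 0) l.
have qn : (q <= n)%N by rewrite -lsz find_size.
have lq k : (l`_k != 0) = (k < q)%N.
  have [lt_kq|le_qk] := ltnP k q.
    by have /= -> := before_find 0 lt_kq.
  apply/negbTE; rewrite negbK.
  have [le_lk|lt_kl] := leqP (size l) k; first by rewrite nth_default.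
  have hl : has (pred1 0) l by rewrite has_find (leq_ltn_trans le_qk).
  have lq0 : l`_q = 0 by apply/eqP/(nth_find 0 hl).
  by have := eigs_gram_antitone A le_qk; rewrite -/l lq0 eq_le eigs_gram_ge0 => ->.
by rewrite lq (mxrank_gram_diag UU UG qn) // => k; rewrite mxE.
Qed.

(** * Generating function of volume sampling *)

Lemma subrows_mulmx_tr (R : realType) m n (A : 'M[R]_(m, n)) (B : 'M[R]_n) S :
  subrows S A *m B *m (subrows S A)^T
  = mxsub (@set_elt m S) (@set_elt m S) (A *m B *m A^T).
Proof. by rewrite mxsub_mul -trmx_mxsub -mul_rowsub_mx. Qed.

(** Sylvester's identity moves the right side to size [m], where [det_gram_update] evaluates each
    principal minor. The powers of ['X] keep the subset sizes apart. *)
Lemma vol_generating (R : realType) m n (A : 'M[R]_(m, n)) (u v : 'rV[R]_n) :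
  \sum_(S : {set 'I_m})
    (vol_weight A S * (1 + (v *m (pinv (subrows S A) *m subrows S A) *m u^T) 0 0))%:P
      * 'X^#|S|
  = \det (1%:M + 'X *: map_mx polyC (A^T *m A *m (1%:M + u^T *m v))).
Proof.
rewrite -mulmxA map_mxM scalemxAl -det_1addM_comm -scalemxAr -map_mxM.
rewrite det_1addZ_principal_minors.
apply: eq_bigr => S _; rewrite mulrC -map_mxsub det_map_mx; congr (_ * _%:P).
by rewrite -subrows_mulmx_tr det_gram_update.
Qed.

Section Diag.
Variables (R : realType) (m n : nat) (A : 'M[R]_(m, n)).
Variables (U : 'M[R]_n) (d : 'rV[R]_n).
Hypotheses (UU : U *m U^T = 1%:M) (UG : U *m (A^T *m A) = diag_mx d *m U).

Lemma det_1addX_conj (M : 'M[R]_n) :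
  \det (1%:M + 'X *: map_mx polyC (U^T *m M *m U)) = \det (1%:M + 'X *: map_mx polyC M).
Proof.
rewrite !map_mxM -mulmxA scalemxAr det_1addM_comm -scalemxAl -mulmxA -map_mxM.
by rewrite UU map_mx1 mulmx1.
Qed.

Let D : 'rV[{poly R}]_n := \row_k (1 + d 0 k *: 'X).

Lemma map_1addX_diag : 1%:M + 'X *: map_mx polyC (diag_mx d) = diag_mx D.
Proof.
apply/matrixP => k l; rewrite !mxE polyCMn.
by case: eqP; rewrite ?mulr1n ?mulr0n ?mulr0 ?addr0 // mulrC mul_polyC.
Qed.

Lemma prod_1addX (P : pred 'I_n) :
  \prod_(k | P k) D 0 k = \prod_(k | P k) (1 + d 0 k *: 'X).
Proof. by apply: eq_bigr => k _; rewrite mxE. Qed.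

Lemma det_1addX_diag_delta (c : R) i j :
  \det (1%:M + 'X *: map_mx polyC (diag_mx d + c *: delta_mx i j))
  = \prod_k (1 + d 0 k *: 'X) + (c *: 'X) *+ (i == j) * \prod_(k | k != i) (1 + d 0 k *: 'X).
Proof.
rewrite map_mxD scalerDr addrA map_1addX_diag map_mxZ /= map_delta_mx scalerA.
by rewrite mulrC mul_polyC det_diagD_delta !prod_1addX.
Qed.

(** In the eigenbasis the rank-one update changes a single entry, which brings the determinant
    within reach of [det_diagD_delta]. *)
Lemma gram_update i j :
  A^T *m A *m (1%:M + (row i U)^T *m row j U)
  = U^T *m (diag_mx d + d 0 i *: delta_mx i j) *m U.
Proof.
rewrite (gram_diag UU UG) !rowE trmx_mul trmx_delta.
rewrite mulmxDr mulmx1 mulmxDr mulmxDl; congr (_ + _).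
rewrite !mulmxA -[_ *m U *m U^T]mulmxA UU mulmx1; congr (_ *m _).
rewrite -!mulmxA mul_delta_mx; congr (_ *m _).
by apply/matrixP => k l; rewrite mul_diag_mx !mxE; case: eqP => [->|]; rewrite ?mulr0.
Qed.

Lemma coef_sum_setX (w : {set 'I_m} -> R) s :
  (\sum_(S : {set 'I_m}) (w S)%:P * 'X^#|S|)`_s = \sum_(S : {set 'I_m} | #|S| == s) w S.
Proof.
rewrite coef_sum [RHS]big_mkcond; apply: eq_bigr => S _.
by rewrite coefCM coefXn eq_sym; case: eqP; rewrite ?mulr1 ?mulr0.
Qed.

Lemma vol_weight_sum s :
  \sum_(S : {set 'I_m} | #|S| == s) vol_weight A S
  = (\prod_k (1 + d 0 k *: 'X))`_s.
Proof.
rewrite -coef_sum_setX; congr ((polyseq _)`_s).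
(* The generating function at [u = v = 0], where the projections drop out. *)
transitivity (\det (1%:M + 'X *: map_mx polyC (A^T *m A *m (1%:M + (0 : 'rV_n)^T *m 0)))).
  rewrite -vol_generating. apply: eq_bigr => S _.
  by rewrite !mul0mx mxE addr0 mulr1.
rewrite trmx0 mul0mx addr0 mulmx1 (gram_diag UU UG) det_1addX_conj.
by rewrite map_1addX_diag det_diag prod_1addX.
Qed.

(** Compare coefficients of degree [s.+1] in the generating function at two eigenvectors. The total
    weight cancels, and the factor ['X] of the update lowers the degree to [s]. *)
Lemma vol_weight_proj_sum s :
  U *m (\sum_(S : {set 'I_m} | #|S| == s.+1)
          vol_weight A S *: (pinv (subrows S A) *m subrows S A)) *m U^T
  = diag_mx (\row_i (d 0 i * (\prod_(k | k != i) (1 + d 0 k *: 'X))`_s)).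
Proof.
apply/matrixP => j i.
have := congr1 (coefp s.+1) (vol_generating A (row i U) (row j U)).
rewrite gram_update det_1addX_conj det_1addX_diag_delta /= coef_sum_setX.
rewrite coefD -vol_weight_sum.
rewrite (eq_bigr (fun S => vol_weight A S + vol_weight A S *
  (row j U *m (pinv (subrows S A) *m subrows S A) *m (row i U)^T) 0 0)) => [|S _];
  last by rewrite mulrDr mulr1.
rewrite big_split /= => /addrI E.
rewrite mulmx_sumr mulmx_suml summxE.
transitivity (\sum_(S : {set 'I_m} | #|S| == s.+1) vol_weight A S *
  (row j U *m (pinv (subrows S A) *m subrows S A) *m (row i U)^T) 0 0).
  apply: eq_bigr => S _; rewrite -scalemxAr -scalemxAl mxE; congr (_ * _).
  rewrite -row_mul [LHS]mxE [RHS]mxE; apply: eq_bigr => k _.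
  by rewrite !mxE.
rewrite {}E mulrnAl coefMn -scalerAl coefZ coefXM /= !mxE.
by rewrite eq_sym; case: eqP => [->|]; rewrite ?mulr1n ?mulr0n.
Qed.
End Diag.

(** * Elementary symmetric polynomials *)

Section Esym.
Variables (R : realFieldType).

Lemma coefSM1addZX (p : {poly R}) (c : R) s :
  (p * (1 + c *: 'X))`_s.+1 = p`_s.+1 + c * p`_s.
Proof. by rewrite mulrDr mulr1 coefD -scalerAr coefZ coefMX. Qed.

Lemma coef0M1addZX (p : {poly R}) (c : R) : (p * (1 + c *: 'X))`_0 = p`_0.
Proof. by rewrite mulrDr mulr1 coefD -scalerAr coefZ coefMX mulr0 addr0. Qed.

Lemma coef_prod1addZX_ge0 I (r : seq I) (P : pred I) (a : I -> R) s :
  (forall i, 0 <= a i) -> 0 <= (\prod_(i <- r | P i) (1 + a i *: 'X))`_s.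
Proof.
move=> a0; elim/big_rec: _ s => [s|i p _ IHp s]; first by rewrite coef1 ler0n.
rewrite mulrC; case: s => [|s]; rewrite ?coef0M1addZX ?coefSM1addZX //.
by rewrite addr_ge0 // mulr_ge0.
Qed.

Variables (a : nat -> R) (a0 : forall i, 0 <= a i).
Let E k : {poly R} := \prod_(i < k) (1 + a i *: 'X).

Let ES k : E k.+1 = E k * (1 + a k *: 'X).
Proof. by rewrite /E big_ord_recr. Qed.

Lemma coef_prod1addZX_mono k l s : (k <= l)%N -> (E k)`_s <= (E l)`_s.
Proof.
move=> /subnK <-; elim: (l - k)%N => [//|p IHp]; apply: (le_trans IHp).
rewrite addSn ES; case: s {IHp} => [|s]; rewrite ?coef0M1addZX ?coefSM1addZX //.
by rewrite lerDl mulr_ge0 // coef_prod1addZX_ge0.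
Qed.

Lemma coef_prod1addZX_eq0 k s : (k < s)%N -> (E k)`_s = 0.
Proof.
elim: k s => [|k IHk] [|s] // ks; first by rewrite /E big_ord0 coef1.
by rewrite ES coefSM1addZX !IHk ?mulr0 ?addr0 // ltnW.
Qed.

Lemma coef_prod1addZX_gt0 k s : (forall i, (i < k)%N -> 0 < a i) -> (s <= k)%N ->
  0 < (E k)`_s.
Proof.
elim: k s => [|k IHk] [|s] // ap sk; first by rewrite /E big_ord0 coef1.
  by rewrite ES coef0M1addZX IHk // => i ik; rewrite ap // ltnW.
rewrite ES coefSM1addZX ltr_wpDl ?coef_prod1addZX_ge0 // mulr_gt0 ?ap //.
by rewrite IHk // => i ik; rewrite ap // ltnW.
Qed.

(* Split the monomials of [e_(s+1)] according to their last variable. *)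
Lemma coef_prod1addZX_le k r s : (k <= r.+1)%N ->
  (E k)`_s.+1 <= (E r)`_s * \sum_(s <= i < k) a i.
Proof.
elim: k => [_|k IHk lt_kr].
  by rewrite /E big_ord0 coef1 big_geq // mulr0.
have [lt_ks|le_sk] := ltnP k s.
  by rewrite big_geq // mulr0 coef_prod1addZX_eq0 // ltnS ltnW.
rewrite ES coefSM1addZX big_nat_recr //= mulrDr lerD ?IHk // 1?ltnW //.
by rewrite mulrC ler_wpM2r // coef_prod1addZX_mono.
Qed.

End Esym.

(** Let [Q] omit both factors. Expanding the remaining one, both sides share a term in [a i * a j],
    and what is left compares [a j] with [a i] times a nonnegative coefficient of [Q]. *)
Lemma coef_prod1addZX_exchange (R : realFieldType) (I : finType) (a : I -> R) (i j : I) s :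
  (forall k, 0 <= a k) -> a j <= a i ->
  a j * (\prod_(k | k != j) (1 + a k *: 'X))`_s
    <= a i * (\prod_(k | k != i) (1 + a k *: 'X))`_s.
Proof.
move=> a0 le_ji; have [<-//|ij] := eqVneq i j.
pose Q : {poly R} := \prod_(k | (k != i) && (k != j)) (1 + a k *: 'X).
have Ei : \prod_(k | k != i) (1 + a k *: 'X) = Q * (1 + a j *: 'X).
  by rewrite (bigD1 j) 1?eq_sym //= mulrC.
have Ej : \prod_(k | k != j) (1 + a k *: 'X) = Q * (1 + a i *: 'X).
  rewrite (bigD1 i) //= mulrC; congr (_ * _); apply: eq_bigl => k.
  by rewrite andbC.
have Q0 t : 0 <= Q`_t by apply: coef_prod1addZX_ge0.
rewrite Ei Ej; case: s => [|s]; rewrite ?coef0M1addZX ?coefSM1addZX.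
  exact: ler_wpM2r.
by rewrite !mulrDr mulrCA lerD2r ler_wpM2r.
Qed.

(** * Contraction of the mean iteration *)

Section Volume.
Variables (R : realType) (m n : nat) (A : 'M[R]_(m, n)).
Local Notation G := (A^T *m A).
Local Notation lam i := ((eigs G)`_i).
Local Notation r := (\rank A).
Let E k : {poly R} := \prod_(i < k) (1 + lam i *: 'X).
Let F (i : 'I_n) : {poly R} := \prod_(k < n | k != i) (1 + lam k *: 'X).
(** The orthogonal projection onto the row space of [subrows S A]. *)
Definition proj_rows S : 'M[R]_n := pinv (subrows S A) *m subrows S A.

Lemma prod_1addX_eigs k : (r <= k)%N -> E k = E r.
Proof.
move=> /subnK <-; elim: (k - r)%N => [//|p IHp].
rewrite addSn /E big_ord_recr /= -/(E _) IHp.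
have -> : lam (p + r) = 0 by apply/eqP; rewrite -[_ == _]negbK eigs_gram_neq0 -leqNgt leq_addl.
by rewrite scale0r addr0 mulr1.
Qed.

Lemma prod_1addX_eigs_drop i : F i * (1 + lam i *: 'X) = E r.
Proof.
rewrite -(@prod_1addX_eigs n) ?rank_leq_col //.
by rewrite /E (bigD1 i) //= mulrC.
Qed.

(** Both sides times [1 + lam i *: 'X] give [E r], and this factor cancels since its constant
    coefficient is 1. *)
Lemma prod_1addX_eigs_drop_last (i : 'I_n) : i.+1 = r -> F i = E i.
Proof.
move=> ir; have : F i * (1 + lam i *: 'X) = E i * (1 + lam i *: 'X).
  by rewrite prod_1addX_eigs_drop -ir /E big_ord_recr.
apply: mulIf; apply/eqP => /(congr1 (coefp 0)) /=.
by rewrite coefD coef1 coefZ coefX mulr0 addr0 coef0 => /eqP; rewrite oner_eq0.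
Qed.

Lemma eigs_gram_gt0 i : (i < r)%N -> 0 < lam i.
Proof. by move=> ir; rewrite lt0r eigs_gram_neq0 ir eigs_gram_ge0. Qed.

Lemma sigma_sqr i : sigma A i.+1 ^+ 2 = lam i.
Proof. by rewrite sqr_sqrtr ?eigs_gram_ge0. Qed.

Variable s : nat.
Hypothesis sr : (s < r)%N.

(** The sample size is [s.+1] here; indices shift by one because [sigma] counts from 1 and the
    eigenvalue list from 0. *)
Lemma rhoE : rho A s.+1 = lam r.-1 / \sum_(s <= i < r) lam i.
Proof.
rewrite /rho big_add1 /= -{1}(ltn_predK sr) sigma_sqr.
by congr (_ / _); apply: eq_bigr => i _; rewrite sigma_sqr.
Qed.

Lemma esym_eigs_gt0 : 0 < (E r)`_s.+1.
Proof.
by apply: coef_prod1addZX_gt0 => // i; [exact: eigs_gram_ge0 | exact: eigs_gram_gt0].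
Qed.

Lemma sum_eigs_gt0 : 0 < \sum_(s <= i < r) lam i.
Proof.
rewrite big_ltn // ltr_wpDr ?eigs_gram_gt0 // sumr_ge0 // => i _.
exact: eigs_gram_ge0.
Qed.

(** The eigenvalue of the mean error map on the [i]-th eigenvector, see [mean_step_diag]. *)
Definition contraction (i : 'I_n) : R := 1 - lam i * (F i)`_s / (E r)`_s.+1.

(** The lower bound, which makes powers monotone, splits [e_(s+1)] according to whether [lam i]
    occurs. For the upper bound, the exchange lemma reduces to the last positive eigenvalue, where
    [coef_prod1addZX_le] applies. *)
Lemma contraction_bounds (i : 'I_n) : (i < r)%N ->
  0 <= contraction i <= 1 - rho A s.+1.
Proof.
move=> ir; apply/andP; split.
  rewrite subr_ge0 ler_pdivrMr ?esym_eigs_gt0 // mul1r.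
  rewrite -(prod_1addX_eigs_drop i) coefSM1addZX lerDr.
  by apply: coef_prod1addZX_ge0 => k; apply: eigs_gram_ge0.
rewrite lerD2l lerN2 rhoE ler_pdivrMr ?sum_eigs_gt0 // mulrAC.
rewrite ler_pdivlMr ?esym_eigs_gt0 //.
have rn : (r.-1 < n)%N by rewrite (leq_trans _ (rank_leq_col A)) // (ltn_predK sr).
pose j := Ordinal rn.
have Fj : F j = E r.-1 by apply: prod_1addX_eigs_drop_last; rewrite /= (ltn_predK sr).
have H1 : lam r.-1 * (E r.-1)`_s <= lam i * (F i)`_s.
  rewrite -Fj; apply: (@coef_prod1addZX_exchange R 'I_n (fun k => lam k) i j s).
    by move=> k; apply: eigs_gram_ge0.
  by apply: eigs_gram_antitone; rewrite -ltnS (ltn_predK sr).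
apply: le_trans (ler_wpM2r (ltW sum_eigs_gt0) H1).
rewrite -mulrA ler_wpM2l ?eigs_gram_ge0 //.
by apply: coef_prod1addZX_le => [k|]; rewrite ?eigs_gram_ge0 // (ltn_predK sr).
Qed.

Definition mean_step : 'M[R]_n :=
  \sum_(S : {set 'I_m}) vol_prob A s.+1 S *: (1%:M - proj_rows S).

(** The total weight is positive, so the probabilities sum to 1 and the mean step is the identity
    minus the mean projection. *)
Lemma mean_step_diag (U : 'M[R]_n) : U *m U^T = 1%:M ->
  U *m G = diag_mx (\row_i lam i) *m U ->
  U *m mean_step = diag_mx (\row_i contraction i) *m U.
Proof.
move=> UU UG.
have sumE : \sum_(S : {set 'I_m} | #|S| == s.+1) vol_weight A S = (E r)`_s.+1.
  rewrite (vol_weight_sum UU UG) -(@prod_1addX_eigs n) ?rank_leq_col //.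
  by congr ((polyseq _)`_ _); apply: eq_bigr => k _; rewrite mxE.
have meanE : mean_step = 1%:M - ((E r)`_s.+1)^-1 *:
  \sum_(S : {set 'I_m} | #|S| == s.+1) vol_weight A S *: proj_rows S.
  rewrite /mean_step /vol_prob (bigID (fun S : {set 'I_m} => #|S| == s.+1)) /=.
  rewrite [X in _ + X]big1 => [|S /negPf ->]; last by rewrite scale0r.
  rewrite addr0; under eq_bigr => S HS do rewrite HS sumE scalerBr.
  rewrite sumrB -scaler_suml -mulr_suml sumE divff ?scale1r ?gt_eqF ?esym_eigs_gt0 //.
  congr (_ - _); rewrite scaler_sumr; apply: eq_bigr => S _.
  by rewrite scalerA mulrC.
have projE := vol_weight_proj_sum UU UG s.
rewrite -[LHS]mulmx1 -(mulmx1C UU) mulmxA; congr (_ *m _).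
rewrite meanE mulmxBr mulmx1 mulmxBl UU -scalemxAr -scalemxAl projE.
apply/matrixP => i j; rewrite !mxE /contraction.
under eq_bigr do rewrite mxE.
by case: eqP; rewrite ?mulr1n ?mulr0n ?mulr0 ?subr0 // mulrC.
Qed.

End Volume.

(** * Independence and the expected error *)

Lemma scalemx_prod (R : comNzRingType) n k (a : 'I_k -> R) (M : 'I_k -> 'M[R]_n) :
  \prod_(i < k) (a i *: M i) = (\prod_(i < k) a i) *: \prod_(i < k) M i.
Proof.
elim: k a M => [|k IHk] a M; first by rewrite !big_ord0 scale1r.
by rewrite !big_ord_recr /= IHk -!mulmxE -scalemxAl -scalemxAr scalerA.
Qed.

Section Iterate.
Variables (R : realType) (m n : nat) (A : 'M[R]_(m, n)) (b : 'cV[R]_m).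
Variables (x0 xs : 'cV[R]_n).
Hypothesis Axs : A *m xs = b.

Lemma step_sub (S : {set 'I_m}) x : step A b S x - xs = (1%:M - proj_rows A S) *m (x - xs).
Proof.
have -> : step A b S x = x - proj_rows A S *m (x - xs).
  rewrite /step -Axs /subrows -mul_rowsub_mx -mulmxBr mulmxA //.
by rewrite mulmxBl mul1mx addrAC.
Qed.

(** Transposed so that the newest step multiplies on the right, as in [\prod_(i < k)]; the step
    matrices are symmetric. *)
Lemma iterate_sub_tr (Ss : nat -> {set 'I_m}) k :
  (iterate A b x0 Ss k - xs)^T
  = (x0 - xs)^T *m \prod_(i < k) (1 - proj_rows A (Ss i)).
Proof.
elim: k => [|k IHk]; first by rewrite big_ord0 mulmx1.
rewrite big_ord_recr /= step_sub trmx_mul IHk [(1%:M - _)^T]linearB /= trmx1 pinv_proj_tr.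
by rewrite -mulmxA.
Qed.

(** Independence: expanding the [k]-th power of the sum defining [mean_step] gives a sum over
    [k]-tuples of index sets with product weights. *)
Lemma expect_diff_tr s k :
  (expect_diff A b s.+1 x0 xs k)^T = (x0 - xs)^T *m mean_step A s ^+ k.
Proof.
rewrite /expect_diff linear_sum /= /mean_step.
rewrite -[in RHS](card_ord k) -prodr_const bigA_distr_bigA mulmx_sumr.
apply: eq_bigr => f _; rewrite linearZ /= iterate_sub_tr scalemx_prod -scalemxAr.
(* Only indices below [k] are read, so the default [set0] never occurs. *)
congr (_ *: (_ *m _)); apply: eq_bigr => i _; by rewrite valK.
Qed.
End Iterate.

Lemma sqnorm_orthogonal (R : realType) n (U : 'M[R]_n) (v : 'cV[R]_n) :
  U *m U^T = 1%:M -> sqnorm v = \sum_i (v^T *m U^T) 0 i ^+ 2.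
Proof.
move=> UU; have UU' := mulmx1C UU.
transitivity ((v^T *m U^T *m (v^T *m U^T)^T) 0 0).
  rewrite trmx_mul !trmxK mulmxA -[_ *m U^T *m U]mulmxA UU' mulmx1.
  by rewrite mxE; apply: eq_bigr => i _; rewrite mxE expr2.
by rewrite mxE; apply: eq_bigr => i _; rewrite [X in _ * X]mxE expr2.
Qed.

Lemma mulmx_exp_diag (R : comNzRingType) n (U M : 'M[R]_n) (d c : 'rV[R]_n) k :
  U *m M = diag_mx d *m U -> c *m U *m M ^+ k = (\row_i (d 0 i ^+ k * c 0 i)) *m U.
Proof.
move=> UM; elim: k => [|k IHk].
  by rewrite mulmx1; congr (_ *m _); apply/rowP => i; rewrite mxE mul1r.
rewrite exprSr mulmxA IHk -mulmxA UM mulmxA; congr (_ *m _).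
by rewrite mul_mx_diag; apply/rowP => i; rewrite !mxE exprSr mulrAC.
Qed.

Theorem theorem3p2 (R : realType) (m n : nat) (A : 'M[R]_(m, n)) (b : 'cV[R]_m)
  (s : nat) (x0 : 'cV[R]_n) :
  (exists x : 'cV[R]_n, A *m x = b) ->
  (1 <= s)%N -> (s <= \rank A)%N ->
  let x0s := pinv A *m b + (1%:M - pinv A *m A) *m x0 in
  forall k : nat,
    sqnorm (expect_diff A b s x0 x0s k)
      <= (1 - rho A s) ^+ (2 * k) * sqnorm (x0 - x0s).
Proof.
case=> x Ax; case: s => [//|s] _ sr x0s k.
have [AXA _ _ _] := pinvP A.
have Ax0s : A *m x0s = b.
  rewrite /x0s mulmxDr !mulmxA mulmxBr mulmx1 !mulmxA AXA subrr mul0mx addr0.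
  by rewrite -Ax !mulmxA AXA.
have [_ _ [U UU UG]] := eigs_gram A.
pose c := (x0 - x0s)^T *m U^T.
(* The initial error is the projection of [x0 - x] onto the row space of [A], hence orthogonal to
   the kernel eigenvectors. *)
have c0 (i : 'I_n) : (\rank A <= i)%N -> c 0 i = 0.
  move=> ri; have di : (\row_i (eigs (A^T *m A))`_i) 0 i = 0.
    by apply/eqP; rewrite mxE -[_ == _]negbK eigs_gram_neq0 -leqNgt.
  have UA := gram_eigenvalue0 UU UG di.
  have -> : c 0 i = ((x0 - x0s)^T *m (row i U)^T) 0 0.
    by rewrite !mxE; apply: eq_bigr => j _; rewrite !mxE.
  have -> : x0 - x0s = pinv A *m A *m (x0 - x).
    rewrite /x0s -Ax mulmxA mulmxBl mul1mx. rewrite mulmxBr opprD opprB addrCA.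
    by rewrite [x0 + _]addrC subrK addrC.
  rewrite trmx_mul pinv_proj_tr -!mulmxA -[A *m _]trmxK trmx_mul trmxK UA.
  by rewrite trmx0 !mulmx0 mxE.
have cU : (x0 - x0s)^T = c *m U by rewrite -mulmxA (mulmx1C UU) mulmx1.
rewrite !(sqnorm_orthogonal _ UU) (expect_diff_tr _ Ax0s) -/c cU.
rewrite (mulmx_exp_diag _ _ (mean_step_diag sr UU UG)) -mulmxA UU mulmx1 mulr_sumr.
(* The bound holds coordinate by coordinate. Beyond the rank the contraction factor is 1, but the
   coordinate vanishes. *)
clearbody c; apply: ler_sum => i _; rewrite !mxE exprMn mulnC exprM.
have [ir|ri] := ltnP i (\rank A); last by rewrite c0 // expr0n !mulr0.
have /andP[ci0 ci1] := contraction_bounds sr ir.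
rewrite ler_wpM2r ?sqr_ge0 // -!exprM.
by rewrite lerXn2r ?nnegrE // (le_trans ci0).
Qed.
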